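(* Let $G$ be a graph and let $\mathcal{H}$ be the set of all induced subgraphs of $G$. Then $$\varphi(G) \geq \max_{H\in\mathcal{H}} \dfrac{1}{2}\left(\chi(H)-\omega(H)\right).$$
   Context: All graphs are finite, simple and undirected, with at least one vertex. $\chi$ denotes the chromatic number and $\omega$ the clique number. For a proper vertex coloring $c$ of $G$ and an induced subgraph $H$ of $G$, let $c(H)$ be the set of colors used by $c$ on the vertices of $H$. Define $\varphi_c(G)=\max_{H}\,(|c(H)|-\chi(H))$, the maximum over all induced subgraphs $H$ of $G$. The chromatic discrepancy is $\varphi(G)=\min_c \varphi_c(G)$, the minimum over all proper colorings $c$ of $G$ (with any number of colors). *)

(* Defs.v *)
From mathcomp Require Import all_boot all_order all_algebra.
From mathcomp Require Import boolp.

Set Implicit Arguments.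
Unset Strict Implicit.
Unset Printing Implicit Defensive.

(* The vertex set may be empty here; nonemptiness is required wherever a graph
   is quantified over, including in the maxima over induced subgraphs below. *)
Record sgraph := SGraph {
  vertex :> finType;
  edge : rel vertex;
  edge_sym : symmetric edge;
  edge_irr : irreflexive edge }.

Section Induced.
Variables (G : sgraph) (A : {set G}).

Definition induced_edge : rel {x : G | x \in A} :=
  fun x y => edge (val x) (val y).

Lemma induced_edge_sym : symmetric induced_edge.
Proof. by move=> x y; rewrite /induced_edge edge_sym. Qed.

Lemma induced_edge_irr : irreflexive induced_edge.
Proof. by move=> x; rewrite /induced_edge edge_irr. Qed.

Definition induced : sgraph := SGraph induced_edge_sym induced_edge_irr.
End Induced.

Definition proper_coloring (G : sgraph) (C : finType) (c : {ffun G -> C}) : bool :=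
  [forall x, forall y, edge x y ==> (c x != c y)].

Definition colorable (G : sgraph) (k : nat) : bool :=
  [exists c : {ffun G -> 'I_k}, proper_coloring c].

Lemma rank_coloring_proper (G : sgraph) :
  proper_coloring [ffun x : G => enum_rank x].
Proof.
apply/forallP => x; apply/forallP => y; apply/implyP => exy; rewrite !ffunE.
by apply: contraTneq exy => /enum_rank_inj ->; rewrite edge_irr.
Qed.

Lemma colorable_ex (G : sgraph) : exists k, colorable G k.
Proof. by exists #|G|; apply/existsP; eexists; apply: rank_coloring_proper. Qed.

Definition chi (G : sgraph) : nat := ex_minn (colorable_ex G).

Definition clique (G : sgraph) (K : {set G}) : bool :=
  [forall x in K, forall y in K, (x != y) ==> edge x y].

Definition omega (G : sgraph) : nat := \max_(K : {set G} | clique K) #|K|.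

(* For proper [c] the truncated subtraction is exact: [c] restricted to [A] is
   a proper coloring of [induced A], so [chi (induced A) <= #|c @: A|]. *)
Definition phi_col (G : sgraph) (C : finType) (c : {ffun G -> C}) : nat :=
  \max_(A : {set G} | A != set0) (#|c @: A| - chi (induced A)).

Definition discrepancy_value (G : sgraph) (m : nat) : Prop :=
  exists (k : nat) (c : {ffun G -> 'I_k}), proper_coloring c /\ phi_col c = m.

Lemma discrepancy_value_ex (G : sgraph) : exists m, `[< discrepancy_value G m >].
Proof.
by eexists; apply/asboolP; exists #|G|; eexists; split; first exact: rank_coloring_proper.
Qed.

Definition phi (G : sgraph) : nat := ex_minn (discrepancy_value_ex G).

(* Main.v *)
Require Import Defs.
From mathcomp Require Import all_boot all_order all_algebra.
From mathcomp Require Import boolp zify lra.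

Import Order.TTheory GRing.Theory Num.Theory.
Local Open Scope ring_scope.

(** Fix a proper coloring [c] of [G] and an induced subgraph [H], and choose in
    [H] one vertex of each color of [c(H)], forming a set [T].  Every graph
    satisfies [2 chi <= #|V| + omega]: a pair of distinct non-adjacent vertices
    can be removed at the cost of one color, and when no such pair is left the
    graph is a clique.  Since [chi(T) >= #|T| - phi_c(G)], this yields a clique
    of size at least [#|T| - 2 phi_c(G)] in [T], while [#|T| = #|c(H)| >= chi(H)]. *)

Lemma proper_coloringP (G : sgraph) (C : finType) (c : {ffun G -> C}) :
  reflect (forall x y, edge x y -> c x != c y) (proper_coloring c).
Proof.
by apply: (iffP forallP) => c_ok x; [move=> y; have /forallP/(_ y)/implyP := c_ok x
  | apply/forallP => y; apply/implyP/c_ok].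
Qed.

Lemma cliqueP (G : sgraph) (K : {set G}) :
  reflect {in K &, forall x y, x != y -> edge x y} (clique K).
Proof.
apply: (iffP forall_inP) => [cK x y xK yK neq | cK x xK].
  by have /forall_inP/(_ y yK)/implyP := cK x xK; apply.
by apply/forall_inP => y yK; apply/implyP/cK.
Qed.

(** Numbering the elements of [f @: A] turns [f] into a coloring with exactly that many colors.
    Taking [f] on all of [G] keeps subtypes out of later arguments. *)
Lemma chi_induced_le (G : sgraph) (A : {set G}) (C : finType) (f : G -> C) :
  {in A &, forall x y, edge x y -> f x != f y} ->
  (chi (induced A) <= #|f @: A|)%N.
Proof.
move=> f_ok; rewrite /chi; case: ex_minnP => m _; apply.
have fA (u : induced A) : f (val u) \in f @: A by apply/imset_f/(valP u).
apply/existsP; exists [ffun u => enum_rank_in (fA u) (f (val u))].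
apply/proper_coloringP => u v uv; rewrite !ffunE.
apply: contraNneq (f_ok _ _ (valP u) (valP v) uv) => eq_uv.
rewrite -(enum_rankK_in (fA u) (fA u)) eq_uv.
by rewrite (enum_rankK_in (fA v) (fA v)).
Qed.

(* The value [None] is taken exactly outside [A], hence is a free extra color. *)
Lemma chi_induced_coloring (G : sgraph) (A : {set G}) :
  exists2 f : G -> option 'I_(chi (induced A)),
    {in A &, forall x y, edge x y -> f x != f y}
    & forall x, (f x == None) = (x \notin A).
Proof.
rewrite /chi; case: ex_minnP => m /existsP[c /proper_coloringP c_ok] _.
exists (fun x => omap c (insub x : option (induced A))) => [x y xA yA xy | x].
  by rewrite !insubT /=; apply: contra_neq (c_ok (Sub x xA) (Sub y yA) xy) => -[].
by case: insubP => [u -> _ | /negPf ->].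
Qed.

Lemma chi_induced_clique (G : sgraph) (A : {set G}) :
  exists K : {set G}, [/\ K \subset A, clique K
    & (2 * chi (induced A) <= #|A| + #|K|)%N].
Proof.
have [n] := ubnP #|A|; elim: n A => // n IHn A ltAn.
have [cA | ] := boolP (clique A).
  exists A; split => //; rewrite mul2n -addnn.
  (* Here [K = A], and the identity coloring suffices. *)
  suff chiA : (chi (induced A) <= #|A|)%N by rewrite leq_add.
  apply: leq_trans (chi_induced_le _ _ _ id _) (leq_imset_card _ _) => x y _ _.
  by apply: contraTneq => ->; rewrite edge_irr.
rewrite negb_forall_in => /existsP[x /andP[xA]].
rewrite negb_forall_in => /existsP[y /andP[yA]].
rewrite negb_imply => /andP[neq_xy nxy].
pose B := A :\: [set x; y].
have cardA : #|A| = (#|B| + 2)%N.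
  rewrite -(cardsID [set x; y] A) addnC; congr addn.
  have/setIidPr -> : [set x; y] \subset A.
    by apply/subsetP => z /set2P[] ->.
  by rewrite cards2 neq_xy.
have [|K [KB cK leK]] := IHn B; first by lia.
exists K; split => //; first exact: subset_trans KB (subsetDl _ _).
have [f f_ok fNone] := chi_induced_coloring _ B.
(* One extra color costs 2 on the left, which the two removed vertices pay for. The extra color is
   [None], shared by [x] and [y]. *)
suff: (chi (induced A) <= (chi (induced B)).+1)%N by lia.
apply: (@leq_trans #|f @: A|); last first.
  by rewrite (leq_trans (max_card _)) // card_option card_ord.
apply: chi_induced_le => z t zA tA zt.
have [zB | zB] := boolP (z \in B); have [tB | tB] := boolP (t \in B).
- exact: f_ok.
- by apply: contraTneq zB => eq_zt; rewrite -fNone eq_zt fNone.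
- by apply: contraTneq tB => eq_zt; rewrite -fNone -eq_zt fNone.
(* Both ends lie in [[set x; y]], which spans no edge. *)
- move: zB tB zt; rewrite !inE zA tA !andbT !negbK.
  by move=> /orP[]/eqP-> /orP[]/eqP->; rewrite ?edge_irr ?(negPf nxy) //
    edge_sym (negPf nxy).
Qed.

Lemma clique_le_omega_induced (G : sgraph) (A K : {set G}) :
  K \subset A -> clique K -> (#|K| <= omega (induced A))%N.
Proof.
move=> /subsetP KA /cliqueP cK.
pose L : {set induced A} := [set u | val u \in K].
have cL : clique L.
  apply/cliqueP => u v; rewrite !inE => uK vK neq.
  by apply: cK => //; rewrite (inj_eq val_inj).
have -> : K = [set val u | u in L].
  apply/setP => x; apply/idP/imsetP => [xK | [u]]; last by rewrite inE => uK ->.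
  by exists (Sub x (KA x xK)); rewrite ?inE.
by rewrite card_imset; [apply: leq_bigmax_cond | apply: val_inj].
Qed.

Lemma imset_transversal (aT rT : finType) (f : aT -> rT) (A : {set aT}) :
  exists T : {set aT}, [/\ T \subset A, f @: T = f @: A & #|T| = #|f @: A|].
Proof.
have [-> | [x0 _]] := set_0Vmem A.
  by exists set0; rewrite imset0 !cards0 sub0set.
(* The default [x0] is never reached for [y] in [f @: A]; there [f] is a left inverse of [r], so [r]
   is injective. *)
pose r y := odflt x0 [pick x in A | f x == y].
have rP y : y \in f @: A -> r y \in A /\ f (r y) = y.
  move=> /imsetP[x xA ->]; rewrite /r; case: pickP => [z /andP[zA /eqP] // | /(_ x)].
  by rewrite xA eqxx.
exists (r @: (f @: A)); split.
- by apply/subsetP => _ /imsetP[y /rP[rA _] ->].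
- rewrite -imset_comp -[RHS]imset_id; apply: eq_in_imset => y /rP[_ fr].
  exact: fr.
- by apply: card_in_imset => y z /rP[_ {2}<-] /rP[_ {2}<-] ->.
Qed.

Lemma chi_induced_le_omega_phi_col (G : sgraph) (C : finType)
    (c : {ffun G -> C}) (A : {set G}) :
  proper_coloring c ->
  (chi (induced A) <= omega (induced A) + 2 * phi_col c)%N.
Proof.
move=> /proper_coloringP c_ok.
have chiA : (chi (induced A) <= #|c @: A|)%N.
  by apply: chi_induced_le => x y _ _; apply: c_ok.
have [T [TA cT cardT]] := imset_transversal _ _ c A.
have [K [KT cK leK]] := chi_induced_clique _ T.
have leKA := clique_le_omega_induced _ _ _ (subset_trans KT TA) cK.
(* The maximum in [phi_col] skips the empty set; if [T] is empty, no color occurs on [A] and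
   [chi (induced A)] is 0. *)
have [T0 | T_neq0] := eqVneq T set0; first by move: cardT; rewrite T0 cards0; lia.
have: (#|c @: T| - chi (induced T) <= phi_col c)%N by exact: leq_bigmax_cond.
by rewrite cT; lia.
Qed.

Lemma chi_induced_le_omega_phi (G : sgraph) (A : {set G}) :
  (chi (induced A) <= omega (induced A) + 2 * phi G)%N.
Proof.
(* The minimum [phi G] is attained by some proper coloring [c]. *)
rewrite /phi; case: ex_minnP => m /asboolP[k [c [c_ok <-]]] _.
exact: chi_induced_le_omega_phi_col.
Qed.

(* The default value 0 of the maximum is the value at one-vertex subgraphs. *)
Theorem theorem4p1 (G : sgraph) (G_nonempty : (0 < #|G|)%N) :
  \big[Num.max/0]_(A : {set G} | A != set0)
     (1 / 2%:R * ((chi (induced A))%:R - (omega (induced A))%:R)) <= (phi G)%:R :> rat.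
Proof.
apply: bigmax_le => [|A _]; first exact: ler0n.
have := chi_induced_le_omega_phi _ A.
by rewrite -(ler_nat rat) natrD natrM; lra.
Qed.
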